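(* Let $N\simeq\mathbb{Z}^4$ be a lattice of rank $n=4$, let $\Delta$ be a fan in $N\otimes\mathbb{Q}$, and let $X=X_\Delta$ be the associated toric variety of dimension $4$. Then the spectral sequence $G^l_{pq}(X_\Delta(\mathbb{R}))$ degenerates at order $1$, i.e. $G^{\infty}_{pq}(X_\Delta(\mathbb{R}))=G^{1}_{pq}(X_\Delta(\mathbb{R}))$ for all $p,q$.
   Context: A fan $\Delta$ in $N\otimes\mathbb{Q}$ is a finite nonempty collection of strongly convex rational polyhedral cones, closed under faces, any two meeting in a common face. Let $n$ be the rank of $N$ and $V=N/2N$, a vector space over $\mathbb{F}_2=\mathbb{Z}/2\mathbb{Z}$. For a cone $\sigma\in\Delta$ put $[\sigma]_2=(\mathrm{Vect}_{\mathbb{Q}}(\sigma)\cap N)\otimes\mathbb{Z}/2\mathbb{Z}\subset V$, where $\mathrm{Vect}_{\mathbb{Q}}(\sigma)$ is the $\mathbb{Q}$-linear span of $\sigma$. Let $A_\sigma=H_0(V/[\sigma]_2)$ be the $\mathbb{F}_2$-vector space with basis the symbols $[v]$, $v\in V/[\sigma]_2$; with the product $[v_1][v_2]=[v_1+v_2]$ it is the group algebra $\mathbb{F}_2[V/[\sigma]_2]$. Let $I\subset A_\sigma$ be the augmentation ideal (kernel of $\sum a_i[v_i]\mapsto\sum a_i$) and $I^q$ its $q$-th power, $I^0=A_\sigma$. The complex $A_*(X_\Delta(\mathbb{R}))$ is defined by $A_p=\bigoplus_{\sigma\in\Delta,\ \dim\sigma=n-p}A_\sigma$ for $0\le p\le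 n$, with differential $\partial_p:A_p\to A_{p-1}$ whose restriction to $A_\tau$ ($\dim\tau=n-p$) is $\sum_{\sigma}\pi_{\tau,\sigma}$, the sum being over the cones $\sigma\in\Delta$ with $\dim\sigma=n-p+1$ having $\tau$ as a face, where $\pi_{\tau,\sigma}:A_\tau\to A_\sigma$ is induced by the natural projection $V/[\tau]_2\to V/[\sigma]_2$. Write $I^qA_p=\bigoplus_{\dim\sigma=n-p}I^qA_\sigma$. One has $\partial_p(I^qA_p)\subset I^qA_{p-1}$. The complex is filtered by $F_{-q}(A_p)=I^{q}A_p$ for $q\ge0$. Let $\widetilde G^l_{pq}$ be the associated homological spectral sequence, with $\widetilde G^0_{pq}=F_pA_{p+q}/F_{p-1}A_{p+q}$ ($p\le 0$), and reindex it by $G^l_{pq}=\widetilde G^l_{-q,p+q}$. Thus $G^0_{pq}=I^qA_p/I^{q+1}A_p$ and the differentials are $\partial^l_{pq}:G^l_{pq}\to G^l_{p-1,q+l}$, with $\partial^0_{pq}$ induced by $\partial_p$. *)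

(* Defs.v *)
From HB Require Import structures.
From mathcomp Require Import all_boot all_order all_algebra all_fingroup all_field.
From mathcomp Require Import finmap.
From mathcomp Require Import boolp classical_sets.

Set Implicit Arguments.
Unset Strict Implicit.
Unset Printing Implicit Defensive.

Import Order.TTheory GRing.Theory Num.Theory GroupScope.
Local Open Scope ring_scope.

(* {ffun gT -> K^o} with the convolution product; the alias hides the pointwise
   product that {ffun gT -> K^o} carries by default. *)
Definition galg (K : fieldType) (gT : finGroupType) : Type := {ffun gT -> K^o}.

Section GroupAlgebra.
Variables (K : fieldType) (gT : finGroupType).

HB.instance Definition _ := Vector.copy (galg K gT) {ffun gT -> K^o}.

Implicit Types a b c : galg K gT.

Definition gmul a b : galg K gT :=
  [ffun x => \sum_(y : gT) (a y : K) * (b (y^-1 * x)%g : K)].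

(* the basis element [g] *)
Definition gbase (g : gT) : galg K gT := [ffun x => (x == g)%:R].

Lemma gmulE a b x : gmul a b x = \sum_(y : gT) (a y : K) * (b (y^-1 * x)%g : K).
Proof. by rewrite ffunE. Qed.

Fact gmulA : associative gmul.
Proof.
move=> a b c; apply/ffunP=> x; rewrite !gmulE.
under eq_bigr => y _ do rewrite gmulE mulr_sumr.
under [RHS]eq_bigr => z _ do rewrite gmulE mulr_suml.
rewrite exchange_big /= [RHS]exchange_big /=.
rewrite exchange_big /=; apply: eq_bigr => y _.
rewrite (reindex_inj (mulgI y^-1%g)) /=; apply: eq_bigr => z _.
by rewrite mulrA invMg invgK -mulgA mulKVg.
Qed.

Fact gmul1l : left_id (gbase 1%g) gmul.
Proof.
move=> a; apply/ffunP=> x; rewrite gmulE (bigD1 1%g) //= ffunE eqxx mul1r.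
rewrite invg1 mul1g big1 ?addr0 // => y /negbTE y1.
by rewrite ffunE y1 mul0r.
Qed.

Fact gmul1r : right_id (gbase 1%g) gmul.
Proof.
move=> a; apply/ffunP=> x; rewrite gmulE (bigD1 x) //= ffunE mulVg eqxx mulr1.
rewrite big1 ?addr0 // => y yx; rewrite ffunE.
by rewrite (can2_eq (mulKVg y) (mulKg y)) mulg1 eq_sym (negbTE yx) mulr0.
Qed.

Fact gmulDl : left_distributive gmul +%R.
Proof.
move=> a b c; apply/ffunP=> x; rewrite gmulE !ffunE -big_split /=.
by apply: eq_bigr => y _; rewrite ffunE mulrDl.
Qed.

Fact gmulDr : right_distributive gmul +%R.
Proof.
move=> a b c; apply/ffunP=> x; rewrite gmulE !ffunE -big_split /=.
by apply: eq_bigr => y _; rewrite ffunE mulrDr.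
Qed.

Fact gbase1_neq0 : gbase 1%g != 0.
Proof.
apply/eqP=> /ffunP/(_ 1%g); rewrite !ffunE eqxx => /eqP.
by rewrite oner_eq0.
Qed.

HB.instance Definition _ := GRing.Zmodule_isNzRing.Build (galg K gT)
  gmulA gmul1l gmul1r gmulDl gmulDr gbase1_neq0.

Fact gscalerAl (k : K) a b : k *: (a * b) = (k *: a) * b.
Proof.
apply/ffunP=> x; rewrite !ffunE scaler_sumr; apply: eq_bigr => y _.
by rewrite ffunE scalerAl.
Qed.

Fact gscalerAr (k : K) a b : k *: (a * b) = a * (k *: b).
Proof.
apply/ffunP=> x; rewrite !ffunE scaler_sumr; apply: eq_bigr => y _.
by rewrite ffunE scalerAr.
Qed.

HB.instance Definition _ :=
  GRing.Lmodule_isLalgebra.Build K (galg K gT) gscalerAl.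
HB.instance Definition _ :=
  GRing.Lalgebra_isAlgebra.Build K (galg K gT) gscalerAr.
HB.instance Definition _ := Algebra_isFalgebra.Build K (galg K gT).

Lemma gbaseM (g h : gT) : gbase g * gbase h = gbase (g * h)%g.
Proof.
apply/ffunP=> x; rewrite /GRing.mul /= gmulE (bigD1 g) //= !ffunE eqxx mul1r.
rewrite big1 ?addr0 => [|y /negbTE yg]; last by rewrite ffunE yg mul0r.
by rewrite (can2_eq (mulKVg g) (mulKg g)).
Qed.

Definition gaug a : K^o := \sum_(g : gT) a g.

Fact gaug_is_linear : linear gaug.
Proof.
move=> k a b; rewrite /gaug scaler_sumr -big_split.
by apply: eq_bigr => g _; rewrite !ffunE.
Qed.

HB.instance Definition _ := GRing.isLinear.Build K (galg K gT) K^o _ gaug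
  gaug_is_linear.

Definition augI : {vspace galg K gT} := lker (linfun gaug).

(* I^q; the iteration starts at the whole algebra because the library's
   (augI ^+ 0)%VS is only the line spanned by 1. *)
Definition augIX (q : nat) : {vspace galg K gT} :=
  iter q (fun U => (augI * U)%VS) fullv.

End GroupAlgebra.

Section Cones.
Local Open Scope classical_set_scope.
Variable n : nat.
(* N is Z^n = 'rV[int]_n, N (x) Q is 'rV[rat]_n, and the dual space of the
   latter is 'cV[rat]_n. *)
Implicit Types sigma tau : set 'rV[rat]_n.

Definition NtoQ (w : 'rV[int]_n) : 'rV[rat]_n := map_mx intr w.
Definition Nmod2 (w : 'rV[int]_n) : 'rV['F_2]_n := map_mx intr w.

Definition rational_polyhedral sigma : Prop :=
  exists (k : nat) (v : 'I_k -> 'rV[int]_n),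
    sigma = [set x | exists2 c : 'I_k -> rat,
                       forall i, 0 <= c i & x = \sum_i c i *: NtoQ (v i)].

Definition strongly_convex sigma : Prop :=
  sigma `&` [set x | sigma (- x)] = [set 0].

Definition face tau sigma : Prop :=
  exists2 u : 'cV[rat]_n,
    forall x, sigma x -> 0 <= (x *m u) 0 0 &
    tau = sigma `&` [set x | (x *m u) 0 0 = 0].

Definition is_span sigma (U : {vspace 'rV[rat]_n}) : Prop :=
  (forall x, sigma x -> x \in U) /\
  (forall W : {vspace 'rV[rat]_n}, (forall x, sigma x -> x \in W) -> (U <= W)%VS).

(* Vect_Q(sigma); the default value 0 is never used, by VectP. *)
Definition Vect sigma : {vspace 'rV[rat]_n} := xget 0%VS (is_span sigma).

Lemma VectP sigma : is_span sigma (Vect sigma).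
Proof.
apply: (@xgetPex _ 0%VS (is_span sigma)).
pose P k := `[< exists s : seq 'rV[rat]_n,
  (forall x, x \in s -> sigma x) /\ \dim <<s>> = k >].
have exP : exists k, P k.
  by exists (\dim <<[::] : seq 'rV[rat]_n>>); apply/asboolP; exists [::].
have ubP k : P k -> (k <= \dim {:'rV[rat]_n})%N.
  by move=> /asboolP[s [_ <-]]; rewrite dimvS ?subvf.
case: (ex_maxnP exP ubP) => k /asboolP[s [ss ds]] kmax.
exists <<s>>%VS; split=> [x sx|W sW]; last first.
  by apply/span_subvP => x /ss /sW.
have le_s : (<<s>> <= <<x :: s>>)%VS.
  by apply: sub_span => y ys; rewrite inE ys orbT.
have /kmax : P (\dim <<x :: s>>).
  apply/asboolP; exists (x :: s); split=> // y.
  by rewrite inE => /predU1P[->|/ss].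
rewrite -ds => le_dim.
have /eqP-> : <<s>>%VS == <<x :: s>>%VS by rewrite eqEdim le_s.
by rewrite memv_span // mem_head.
Qed.

Definition cdim sigma : nat := \dim (Vect sigma).

(* [sigma]_2, as the image of Vect_Q(sigma) \cap N in N/2N: since
   Vect_Q(sigma) \cap N is saturated in N, its tensor product with Z/2Z embeds
   in N/2N. *)
Definition mod2_set sigma : {set 'rV['F_2]_n} :=
  [set v | `[< exists2 w : 'rV[int]_n, NtoQ w \in Vect sigma & v = Nmod2 w >]]%SET.

Fact mod2_group_set sigma : group_set (mod2_set sigma).
Proof.
apply/group_setP; split=> [|x y].
  rewrite inE; apply/asboolP; exists 0; first by rewrite /NtoQ raddf0 mem0v.
  by rewrite /Nmod2 raddf0.
rewrite !inE => -[v vs ->] [w ws ->].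
exists (v + w); first by rewrite /NtoQ raddfD memvD.
by rewrite /Nmod2 raddfD.
Qed.
Canonical mod2_group sigma := group (mod2_group_set sigma).

Definition is_fan (Delta : {fset set 'rV[rat]_n}) : Prop :=
  [/\ exists sigma, sigma \in Delta,
      forall sigma, sigma \in Delta ->
        rational_polyhedral sigma /\ strongly_convex sigma,
      forall sigma tau, sigma \in Delta -> face tau sigma -> tau \in Delta &
      forall sigma tau, sigma \in Delta -> tau \in Delta ->
        face (sigma `&` tau) sigma /\ face (sigma `&` tau) tau].

End Cones.

(* The pages of the homological spectral sequence of a filtered complex whose
   chain groups are subspaces of one space C: [d] is the differential and
   [F P m] is the P-th (increasing) filtration step of the degree m chains.  The
   page E^r at filtration P and total degree m (so at bidegree (P, m - P)) is the
   subquotient Z^r / B^r of F_P C_m / F_(P-1) C_m; it is given by the pair of the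
   preimages of Z^r and B^r in F_P C_m, so that equality of pairs is equality of
   subquotients. *)
Section SpectralSequence.
Variables (K : fieldType) (C : vectType K).
Variables (d : 'End(C)) (F : int -> int -> {vspace C}).

(* {c in F_P C_m | d c in F_(P-r) C_(m-1)} *)
Definition ss_cycles (r P m : int) : {vspace C} :=
  (F P m :&: d @^-1: F (P - r)%R (m - 1)%R)%VS.

Definition ss_page (r : nat) (P m : int) : {vspace C} * {vspace C} :=
  ((ss_cycles r P m + F (P - 1)%R m)%VS,
   (d @: ss_cycles (r%:Z - 1)%R (P + r%:Z - 1)%R (m + 1)%R + F (P - 1)%R m)%VS).

(* E^oo for a bounded filtration, with Cm m the space of all degree m chains:
   Z^oo and B^oo come from the cycles and from the boundaries in F_P C_m. *)
Definition ss_page_oo (Cm : int -> {vspace C}) (P m : int) :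
    {vspace C} * {vspace C} :=
  ((F P m :&: lker d + F (P - 1)%R m)%VS,
   (F P m :&: d @: Cm (m + 1)%R + F (P - 1)%R m)%VS).

End SpectralSequence.

Section ToricComplex.
Variables (n : nat) (Delta : {fset set 'rV[rat]_n}).
Implicit Types sigma tau : Delta.

Definition Vquo sigma : finGroupType := coset_of (mod2_set (fsval sigma)).

Definition A_ sigma : falgType 'F_2 := galg 'F_2 (Vquo sigma).

(* The direct sum of all the A_sigma, as the space with basis the disjoint union
   of the bases of the A_sigma; inj_ and proj_ are its structure maps. *)
Definition chains : vectType 'F_2 := 
  {ffun {sigma : Delta & Vquo sigma} -> ('F_2)^o}.

Definition proj_fun sigma (x : chains) : A_ sigma :=
  [ffun c => x (Tagged Vquo c)].

Definition inj_fun sigma (a : A_ sigma) : chains :=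
  [ffun t => if tag t =P sigma is ReflectT e
             then a (ecast s (Vquo s) e (tagged t)) else 0].

(* V/[tau]_2 -> V/[sigma]_2, meaningful when [tau]_2 is contained in [sigma]_2,
   as it is when tau is a face of sigma *)
Definition Vproj tau sigma (c : Vquo tau) : Vquo sigma :=
  coset (mod2_set (fsval sigma)) (repr c).

Definition pi_fun tau sigma (a : A_ tau) : A_ sigma :=
  \sum_(c : Vquo tau) (a c : 'F_2) *: gbase 'F_2 (Vproj sigma c).

Fact proj_is_linear sigma : linear (@proj_fun sigma).
Proof. by move=> k x y; apply/ffunP=> c; rewrite !ffunE. Qed.

Fact inj_is_linear sigma : linear (@inj_fun sigma).
Proof.
move=> k x y; apply/ffunP=> t; rewrite !ffunE; case: eqP => [e|_].
  by rewrite !ffunE.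
by rewrite scaler0 addr0.
Qed.

Fact pi_is_linear tau sigma : linear (@pi_fun tau sigma).
Proof.
move=> k x y; rewrite /pi_fun scaler_sumr -big_split /=.
by apply: eq_bigr => c _; rewrite !ffunE scalerDl scalerA.
Qed.

HB.instance Definition _ sigma := GRing.isLinear.Build 'F_2 chains (A_ sigma) _
  (@proj_fun sigma) (@proj_is_linear sigma).
HB.instance Definition _ sigma := GRing.isLinear.Build 'F_2 (A_ sigma) chains _
  (@inj_fun sigma) (@inj_is_linear sigma).
HB.instance Definition _ tau sigma := GRing.isLinear.Build 'F_2 (A_ tau) (A_ sigma) _
  (@pi_fun tau sigma) (@pi_is_linear tau sigma).

Definition proj_ sigma : 'Hom(chains, A_ sigma) := linfun (@proj_fun sigma).
Definition inj_ sigma : 'Hom(A_ sigma, chains) := linfun (@inj_fun sigma).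
Definition pi_ tau sigma : 'Hom(A_ tau, A_ sigma) := linfun (@pi_fun tau sigma).

(* I^q A_p, a subspace of [chains]; A_p itself is the case q = 0. *)
Definition IA (q : nat) (p : int) : {vspace chains} :=
  (\sum_(sigma : Delta | (cdim (fsval sigma))%:Z == n%:Z - p)
     inj_ sigma @: augIX 'F_2 (Vquo sigma) q)%VS.

Definition facet tau sigma : bool :=
  `[< face (fsval tau) (fsval sigma) >] &&
  (cdim (fsval sigma) == (cdim (fsval tau)).+1).

(* All the differentials A_p -> A_(p-1) at once. *)
Definition bdry : 'End(chains) :=
  \sum_(tau : Delta) \sum_(sigma : Delta | facet tau sigma)
    (inj_ sigma \o pi_ tau sigma \o proj_ tau)%VF.

(* F_(-q) A_p = I^q A_p for q >= 0, and F_P A_p = A_p for P >= 0; recall that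
   Negz m is -(m+1). *)
Definition filt (P p : int) : {vspace chains} :=
  if P is Negz m then IA m.+1 p else IA 0 p.

(* G^l_{pq} is the page l at filtration -q and total degree p. *)
Definition G (l : nat) (p q : int) : {vspace chains} * {vspace chains} :=
  ss_page bdry filt l (- q) p.

Definition G_oo (p q : int) : {vspace chains} * {vspace chains} :=
  ss_page_oo bdry filt (IA 0) (- q) p.

End ToricComplex.

(* Main.v *)
From HB Require Import structures.
Require Import Defs.
From mathcomp Require Import all_boot all_order all_algebra finmap.
From mathcomp Require Import boolp classical_sets.
From mathcomp Require Import all_fingroup all_field zify ring.

(** Degeneration at order 1 amounts to the strictness of the differential for
    the filtration: if x is a chain whose boundary lies in I^q, then that
    boundary is the boundary of some chain in I^q.  Since the algebra of an
    elementary abelian 2-group of order 2^k has I^(k+1) = 0, only q < p matters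
    for x in A_p.

    For q = 1, the augmentation splits off: subtract from each component of x
    its augmentation.  For q = 2 (and p >= n - 1), modulo I^2 each component of x
    in I is [w] - [0] for a unique w; a cone of dimension at most 2 has at most
    two facets, so the condition that the two images of the w's agree modulo I^2
    makes the images of the elements [w] - [0] cancel exactly.

    In dimension 4 there remain q = 3 and p = 4, where x is a single element of
    I^2 in the algebra of V.  If v generates [rho]_2 for some ray rho, then the
    vanishing of x modulo I^3 in V/v gives x = ([v] - [0])([w] - [0]) modulo I^3
    for some w; and such a product, whenever its image in some quotient of V lies
    in I^3, has image 0 there, so it is a cycle. *)

Set Implicit Arguments.
Unset Strict Implicit.
Unset Printing Implicit Defensive.

Import Order.TTheory GRing.Theory Num.Theory.
Local Open Scope ring_scope.

(** * Powers of the augmentation ideal and functions of bounded degree *)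

Section Algebra.
Variables (K : fieldType) (gT : finGroupType).
Local Notation A := (galg K gT).
Implicit Types (a b : A) (g h : gT).

Lemma gbase_mulE g a h : (gbase K g * a) h = a (g^-1 * h)%g.
Proof.
rewrite /GRing.mul /= gmulE (bigD1 g) //= ffunE eqxx mul1r big1 ?addr0 //.
by move=> x /negbTE xg; rewrite ffunE xg mul0r.
Qed.

Lemma gbaseB1_mulE g a h :
  ((gbase K g - 1) * a) h = (a (g^-1 * h)%g : K) - (a h : K).
Proof. by rewrite mulrBl mul1r -gbase_mulE; set u := _ * a; rewrite !ffunE. Qed.

Lemma gbase1 : gbase K (1%g : gT) = 1.
Proof. by []. Qed.

Lemma galg_sum a : a = \sum_g (a g : K) *: gbase K g.
Proof.
apply/ffunP=> x; rewrite sum_ffunE (bigD1 x) //= big1 ?addr0 => [|y yx].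
  by rewrite !ffunE eqxx /GRing.scale /= mulr1.
by rewrite !ffunE eq_sym (negbTE yx) scaler0.
Qed.

Lemma gaug_gbase g : gaug (gbase K g) = 1.
Proof.
rewrite /gaug (bigD1 g) //= big1 ?addr0 => [|y /negbTE yg]; rewrite ffunE ?eqxx //.
by rewrite yg.
Qed.

Lemma gaug1 : gaug (1 : A) = 1.
Proof. exact: gaug_gbase. Qed.

Lemma memv_augI a : (a \in augI K gT) = (gaug a == 0).
Proof. by rewrite memv_ker lfunE. Qed.

Lemma gaug_gbaseM g a : gaug (gbase K g * a) = gaug a.
Proof.
rewrite /gaug [RHS](reindex_inj (mulgI (g^-1)%g)) /=.
by apply: eq_bigr => h _; rewrite gbase_mulE.
Qed.

Lemma gaug_sum a :
  a = (gaug a : K) *: (1 : A) + (\sum_g ((a g : K) *: (gbase K g - 1) : A) : A).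
Proof.
rewrite {1}[a]galg_sum /gaug scaler_suml -big_split /=.
by apply: eq_bigr => g _; rewrite scalerBr addrC subrK.
Qed.

(** The elements $[g]-1$ span $I$ by [gaug_sum], so an inclusion of $I^{q+1}$ can be tested on the
    products $([g]-1)y$ alone. *)
Lemma augIX_ind (T : {vspace A}) q :
  (forall g y, y \in augIX K gT q -> (gbase K g - 1) * y \in T) ->
  (augIX K gT q.+1 <= T)%VS.
Proof.
move=> gT_T; apply/prodvP => u y; rewrite memv_augI => /eqP u0 yq.
rewrite [u]gaug_sum u0 scale0r add0r mulr_suml memv_suml // => g _.
by rewrite -scalerAl memvZ ?gT_T.
Qed.

Lemma gbaseB1_augI g : gbase K g - 1 \in augI K gT.
Proof. by rewrite memv_augI raddfB /= gaug_gbase gaug1 subrr. Qed.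

Lemma gbaseB1_augIX g y q :
  y \in augIX K gT q -> (gbase K g - 1) * y \in augIX K gT q.+1.
Proof. by move=> yq; apply: memv_mul (gbaseB1_augI g) yq. Qed.

Lemma augIX_gbaseM g q y : y \in augIX K gT q -> gbase K g * y \in augIX K gT q.
Proof.
case: q => [_|q]; first exact: memvf.
move=> yq; suff /subvP/(_ y yq) :
    (augIX K gT q.+1 <= amull (gbase K g) @^-1: augIX K gT q.+1)%VS.
  by rewrite -memv_preim lfunE.
apply/prodvP => u z uI zq; rewrite -memv_preim lfunE /= mulrA memv_mul //.
by rewrite memv_augI gaug_gbaseM -memv_augI.
Qed.

Lemma augIX_mull a q y : y \in augIX K gT q -> a * y \in augIX K gT q.
Proof.
move=> yq; rewrite [a]galg_sum mulr_suml memv_suml // => g _.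
by rewrite -scalerAl memvZ ?augIX_gbaseM.
Qed.

Lemma augIXS q : (augIX K gT q.+1 <= augIX K gT q)%VS.
Proof. by apply: augIX_ind => g y yq; rewrite augIX_mull. Qed.

(** The iteration in [augIX] starts from the whole algebra, so $I^1$ is by definition the product
    $I\cdot A$; it is $I$ because $I$ is an ideal. *)
Lemma augIX1 : augIX K gT 1 = augI K gT.
Proof.
apply/eqP; rewrite eqEsubv; apply/andP; split; last first.
  by apply/subvP => x xI; rewrite -[x]mulr1 memv_mul ?memvf.
apply: augIX_ind => g y _.
by rewrite memv_augI mulrBl mul1r raddfB /= gaug_gbaseM subrr.
Qed.

Definition gpair (f : gT -> K) a : K := \sum_g f g * a g.

(* Polynomial functions of degree less than q, through iterated differences:
   they are orthogonal to I^q. *)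
Fixpoint degree_lt q (f : gT -> K) : Prop :=
  if q is q'.+1 then forall g, degree_lt q' (fun h => f (g * h)%g - f h)
  else forall g, f g = 0.

Lemma gpair_gbaseB1 f g a :
  gpair f ((gbase K g - 1) * a) = gpair (fun h => f (g * h)%g - f h) a.
Proof.
rewrite /gpair.
under eq_bigr => h _ do rewrite gbaseB1_mulE mulrDr.
under [RHS]eq_bigr => h _ do rewrite mulrDl.
rewrite !big_split /= (reindex_inj (mulgI g)) /=; congr (_ + _).
  by apply: eq_bigr => h _; rewrite mulKg.
by apply: eq_bigr => h _; rewrite mulrN mulNr.
Qed.

Fact gpair_is_linear f : linear (gpair f : A -> K^o).
Proof.
move=> k a b; rewrite /gpair scaler_sumr -big_split /=.
by apply: eq_bigr => g _; rewrite !ffunE mulrDr mulrCA.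
Qed.

HB.instance Definition _ f :=
  GRing.isLinear.Build K A K^o _ (gpair f : A -> K^o) (gpair_is_linear f).

(** Multiplication by $[g]-1$ is adjoint to taking a difference of [f] ([gpair_gbaseB1]), so each
    factor from $I$ lowers the degree by one. This is how elements are shown to lie outside
    $I^q$. *)
Lemma gpair_augIX q f a : degree_lt q f -> a \in augIX K gT q -> gpair f a = 0.
Proof.
elim: q f a => [|q IHq] f a /=.
  by move=> f0 _; rewrite /gpair big1 // => g _; rewrite f0 mul0r.
move=> fq aq; pose T := lker (linfun (gpair f : A -> K^o)).
suff /subvP/(_ a aq) : (augIX K gT q.+1 <= T)%VS.
  by rewrite memv_ker lfunE => /eqP.
apply: augIX_ind => g y yq; rewrite memv_ker lfunE /=.
by rewrite gpair_gbaseB1 (IHq _ _ (fq g)).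
Qed.

Lemma gpair_gbase f g : gpair f (gbase K g) = f g.
Proof.
rewrite /gpair (bigD1 g) //= big1 ?addr0 => [|y /negbTE yg]; last first.
  by rewrite ffunE yg mulr0.
by rewrite ffunE eqxx mulr1.
Qed.

Lemma eq_degree_lt q f f' : f =1 f' -> degree_lt q f -> degree_lt q f'.
Proof. by move=> /funext->. Qed.

Lemma degree_lt0 q : degree_lt q (fun=> 0).
Proof. by elim: q => //= q IHq g; rewrite subrr. Qed.

Lemma degree_ltD q f f' :
  degree_lt q f -> degree_lt q f' -> degree_lt q (fun h => f h + f' h).
Proof.
elim: q f f' => /= [|q IHq] f f' fq f'q g; first by rewrite fq f'q addr0.
by apply: eq_degree_lt (IHq _ _ (fq g) (f'q g)) => h; rewrite opprD addrACA.
Qed.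

Lemma degree_ltZ q k f : degree_lt q f -> degree_lt q (fun h => k * f h).
Proof.
elim: q f => /= [|q IHq] f fq g; first by rewrite fq mulr0.
by apply: eq_degree_lt (IHq _ (fq g)) => h; rewrite mulrBr.
Qed.

Lemma degree_lt_cst q k : degree_lt q.+1 (fun=> k).
Proof. by move=> g; rewrite subrr; apply: degree_lt0. Qed.

Lemma degree_lt_additive (chi : gT -> K) :
  {morph chi : x y / (x * y)%g >-> x + y} -> degree_lt 2 chi.
Proof.
move=> chiM g; apply: eq_degree_lt (degree_lt_cst 0 (chi g)) => h.
by rewrite chiM addrK.
Qed.

(** A difference of [chi * psi] is a linear combination of [chi], [psi] and a constant. *)
Lemma degree_lt_additiveM (chi psi : gT -> K) :
  {morph chi : x y / (x * y)%g >-> x + y} ->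
  {morph psi : x y / (x * y)%g >-> x + y} ->
  degree_lt 3 (fun x => chi x * psi x).
Proof.
move=> chiM psiM g; apply: (@eq_degree_lt 2 (fun h => chi g * psi h +
    (psi g * chi h + chi g * psi g))) => [h|].
  rewrite chiM psiM; ring.
apply: degree_ltD; first exact/degree_ltZ/(degree_lt_additive psiM).
apply: degree_ltD (degree_lt_cst _ _).
exact/degree_ltZ/(degree_lt_additive chiM).
Qed.

End Algebra.

(** * Elementary abelian 2-groups *)

Section ElementaryAbelian.
Variables (K : fieldType) (gT : finGroupType).
Hypothesis K2 : 2 \in [pchar K].
Hypothesis gT2 : forall x : gT, (x * x = 1)%g.
Local Notation A := (galg K gT).
Implicit Types (a b : A) (g h v w x y : gT).

Lemma involutive_invg g : (g^-1 = g)%g.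
Proof. by rewrite -[RHS](mulKg g) gT2 mulg1. Qed.

Lemma involutive_mulgC g h : (g * h = h * g)%g.
Proof. by rewrite -[LHS]involutive_invg invMg !involutive_invg. Qed.

Lemma addrr2 (V : lmodType K) (u : V) : u + u = 0.
Proof. by rewrite -mulr2n -scaler_nat (pcharf0 K2) scale0r. Qed.

Lemma oppr2 (V : lmodType K) (u : V) : - u = u.
Proof. by apply/eqP; rewrite eq_sym -addr_eq0 addrr2. Qed.

(** The group is abelian and [g] has order at most 2, so joining [g] to [H] adds at most the coset
    $Hg$. *)
Lemma joing_cycleP (H : {group gT}) g h :
  reflect (h \in H \/ (h * g)%g \in H) (h \in H <*> <[g]>)%g.
Proof.
have CH : (<[g]> \subset 'C(H))%g.
  by apply/fintype.subsetP => x _; apply/centP => y _; apply: involutive_mulgC.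
rewrite (cent_joinEr CH); apply: (iffP idP) => [/mulsgP[y z Hy /cycleP[i ->] ->]|].
  have -> : (g ^+ i = if odd i then g else 1)%g.
    elim: i => //= i IHi; rewrite expgS IHi.
    by case: (odd i); rewrite ?gT2 ?mulg1.
  by case: (odd i); rewrite -?mulgA ?gT2 ?mulg1 Hy; [right|left].
case=> [Hh|Hhg]; apply/mulsgP.
  by exists h 1%g; rewrite ?group1 ?mulg1.
by exists (h * g)%g g; rewrite ?cycle_id // -mulgA gT2 mulg1.
Qed.

(* A maximal subgroup avoiding [w] has index 2; [chi] is the indicator of its
   complement. *)
Lemma exists_additive (H : {group gT}) w : w \notin H ->
  exists chi : gT -> K, [/\ {morph chi : x y / (x * y)%g >-> x + y},
    forall h, h \in H -> chi h = 0 & chi w = 1].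
Proof.
move=> Hw; have [M /maxgroupP[Mw maxM] sHM] :=
  @maxgroup_exists gT (fun M => w \notin M) H Hw.
(* Maximality puts [w] in the join of [M] and [x], so everything outside [M] lies in the single
   coset $Mw$. *)
have Mww x : x \notin M -> (x * w)%g \in M.
  move=> Mx; have : w \in (M <*> <[x]>)%g.
    apply: contraNT Mx => /maxM/(_ (joing_subl _ _)) <-.
    by apply/joing_cycleP; right; rewrite gT2 group1.
  by move/joing_cycleP => [ww|]; [rewrite ww in Mw | rewrite involutive_mulgC].
exists (fun x => (x \notin M)%:R); split=> [x y|h Hh|]; last by rewrite Mw.
  case: (boolP (x \in M)) => [Mx|Mx]; first by rewrite groupMl // add0r.
  case: (boolP (y \in M)) => [My|My]; first by rewrite groupMr // Mx addr0.
  rewrite -mulr2n (pcharf0 K2) -[(x * y)%g]mulg1 -(gT2 w) -mulgA.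
  by rewrite (mulgA y) [(y * w * w)%g]involutive_mulgC mulgA groupM // Mww.
by rewrite (fintype.subsetP sHM).
Qed.

(** For [g] in [H] the difference of [f] along [g] vanishes. Otherwise it is invariant under [g] as
    well as under [H], and the index at least halves, so induction applies. *)
Lemma degree_lt_index k (H : {group gT}) (f : gT -> K) :
  (forall h g, h \in H -> f (h * g)%g = f g) -> (#|[set: gT] : H|%g < 2 ^ k)%N ->
  degree_lt k f.
Proof.
elim: k H f => [|k IHk] H f fH.
  by rewrite expn0 ltnNge indexg_gt0.
move=> ltHk g; have [Hg|Hg] := boolP (g \in H).
  apply: eq_degree_lt (degree_lt0 _ _ k) => h.
  by rewrite fH // subrr.
apply: (IHk (H <*> <[g]>)%G) => [h x /joing_cycleP|].
  have Hinv h' x' : h' \in H -> f (g * (h' * x'))%g - f (h' * x')%g = f (g * x')%g - f x'.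
    by move=> Hh'; rewrite (mulgA g) (involutive_mulgC g h') -mulgA !(fH h').
  case=> [/Hinv//|Hhg].
  have hE : h = (h * g * g)%g by rewrite -mulgA gT2 mulg1.
  rewrite hE -(mulgA (h * g)%g g) Hinv // mulgA gT2 mul1g.
  (* Translation by [g] swaps the two terms of the difference; characteristic 2 absorbs the sign. *)
  exact: etrans (esym (@oppr2 K^o _)) (opprB _ _).
rewrite -(@ltn_pmul2r 2) // -expnSr (leq_ltn_trans _ ltHk) //.
rewrite -(Lagrange_index (finset.subsetT (H <*> <[g]>)%G) (joing_subl _ _)) leq_mul2l.
apply/orP; right; rewrite indexg_gt1; apply: contra Hg => /fintype.subsetP; apply.
by apply/joing_cycleP; right; rewrite gT2 group1.
Qed.

(** The indicator of a point is invariant under the trivial subgroup, hence of degree less than [k],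
    and pairing with it reads off a coefficient of [a]. *)
Lemma augIX_eq0 k a : (#|gT| < 2 ^ k)%N -> a \in augIX K gT k -> a = 0.
Proof.
move=> ltk ak; apply/ffunP=> g; rewrite ffunE.
have f0 : degree_lt k (fun h : gT => (h == g)%:R : K).
  apply: (@degree_lt_index _ 1%G) => [h x|].
    by rewrite inE => /eqP->; rewrite mul1g.
  by rewrite indexg1 cardsT.
have := gpair_augIX f0 ak; rewrite /gpair (bigD1 g) //= eqxx mul1r big1 ?addr0 //.
by move=> h /negbTE->; rewrite mul0r.
Qed.

(** If $w\ne1$, an additive function with value 1 at [w] has degree less than 2 and pairs to 1 with
    $[w]-1$. *)
Lemma gbaseB1_augIX2 w : gbase K w - 1 \in augIX K gT 2 -> w = 1%g.
Proof.
move=> w2; apply/eqP; apply: contraTT isT => w1.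
have [|chi [chiM chi1 chiw]] := @exists_additive 1%G w; first by rewrite inE.
have /eqP := gpair_augIX (degree_lt_additive chiM) w2.
by rewrite raddfB /= -gbase1 !gpair_gbase chiw chi1 ?group1 // subr0 oner_eq0.
Qed.

Lemma gbaseB1M v w :
  (gbase K v - 1) * (gbase K w - 1) = gbase K (v * w)%g - gbase K v - gbase K w + 1.
Proof. by rewrite mulrBl mulrBr mul1r mulr1 gbaseM opprB addrA addrAC. Qed.

(** If [v] and [w] are independent, take additive $\chi,\psi$ with $\chi(v)=1$, $\chi(w)=0$,
    $\psi(w)=1$; then $\chi\psi$ has degree less than 3 and pairs to 1 with the product. In the
    dependent cases $v=1$, $w=1$ or $v=w$ the product is zero, the last one by characteristic 2. *)
Lemma gbaseB1M_augIX3 v w :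
  (gbase K v - 1) * (gbase K w - 1) \in augIX K gT 3 ->
  (gbase K v - 1) * (gbase K w - 1) = 0.
Proof.
move=> vw3; have [w1|w1] := boolP (w \in 1%G).
  by move: w1; rewrite inE => /eqP->; rewrite gbase1 subrr mulr0.
have [/joing_cycleP|vw] := boolP (v \in (1 <*> <[w]>)%g).
  have v1 : v \in 1%G -> v = 1%g by rewrite inE => /eqP.
  case=> [/v1->|]; first by rewrite gbase1 subrr mul0r.
  rewrite inE => /eqP vw; have -> : v = w by rewrite -[v]mulg1 -(gT2 w) mulgA vw mul1g.
  rewrite gbaseB1M gT2 gbase1 oppr2 -(addrA 1) addrr2 addr0.
  exact: addrr2.
have [chi [chiM chiw chiv]] := exists_additive vw.
have [psi [psiM psi1 psiw]] := exists_additive w1.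
have chiw0 : chi w = 0.
  by apply: chiw; apply/joing_cycleP; right; rewrite gT2 inE.
have chi10 : chi 1%g = 0 by apply: chiw.
have psi10 : psi 1%g = 0 by apply: psi1; rewrite inE.
have /eqP := gpair_augIX (degree_lt_additiveM chiM psiM) vw3.
rewrite gbaseB1M raddfD !raddfB /= -gbase1 !gpair_gbase chiM psiM.
rewrite chiw0 chiv psiw chi10 psi10 !(addr0, mul1r, mul0r, subr0).
by rewrite addrC addKr oner_eq0.
Qed.

End ElementaryAbelian.

(** * Representatives modulo $I^2$ and $I^3$ over $\mathbb{F}_2$ *)

Section OverF2.
Variable gT : finGroupType.
Hypothesis gT2 : forall x : gT, (x * x = 1)%g.
Local Notation A := (galg 'F_2 gT).
Implicit Types (a b : A) (g h v w x y : gT).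

Lemma F2_pchar : 2 \in [pchar 'F_2].
Proof. exact: pchar_Fp. Qed.

Lemma F2_cases (k : 'F_2) : k = 0 \/ k = 1.
Proof. by case: k => [[|[|k]] // lt_k]; [left|right]; apply: val_inj. Qed.

(** The sum of $[g]-1$ and $[w]-1$ differs from $[gw]-1$ by their product, which lies in $I^2$. As
    coefficients are 0 or 1, the whole sum collapses to one term. *)
Lemma augI_gbaseB1 a : a \in augI 'F_2 gT ->
  exists w, a - (gbase 'F_2 w - 1) \in augIX 'F_2 gT 2.
Proof.
rewrite memv_augI => /eqP a0; rewrite [a]gaug_sum a0 scale0r add0r.
elim/big_rec: _ => [|g u _ [w uw]].
  by exists 1%g; rewrite gbase1 !subrr mem0v.
have [->|->] := F2_cases (a g).
  by exists w; rewrite scale0r add0r.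
exists (g * w)%g; rewrite scale1r.
have -> : gbase 'F_2 g - 1 + u - (gbase 'F_2 (g * w)%g - 1) =
  u - (gbase 'F_2 w - 1) - (gbase 'F_2 g - 1) * (gbase 'F_2 w - 1).
  rewrite gbaseB1M; move: (gbase _ (g * w)%g) (gbase _ g) (gbase _ w) (1 : A).
  by move=> p q r s; apply/ffunP => x; rewrite !ffunE; ring.
rewrite memvB // gbaseB1_augIX // augIX1.
exact: gbaseB1_augI.
Qed.

(** Take $b=\chi a$ with $\chi$ additive and $\chi(v)=1$: translation by [v] fixes [a] and changes
    $\chi$ by 1. *)
Lemma gbaseB1_divide a v : v != 1%g -> (forall g, a (v * g)%g = a g) ->
  exists b, a = (gbase 'F_2 v - 1) * b.
Proof.
move=> v1 av.
have [|chi [chiM chi1 chiv]] := @exists_additive _ _ F2_pchar gT2 1%G v.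
  by rewrite inE.
exists [ffun g => chi g * (a g : 'F_2)]; apply/ffunP=> g.
rewrite gbaseB1_mulE !ffunE involutive_invg // av chiM chiv.
by rewrite mulrDl mul1r addrK.
Qed.

(** The element [b] has augmentation 0, since otherwise $[v]-1$ would lie in $I^2$ and [v] would be
    1. So [b] is some $[w]-1$ modulo $I^2$, and the product changes only modulo $I^3$. *)
Lemma augIX2_mod_augIX3 a b v : v != 1%g -> a \in augIX 'F_2 gT 2 ->
  a - (gbase 'F_2 v - 1) * b \in augIX 'F_2 gT 3 ->
  exists w, a - (gbase 'F_2 v - 1) * (gbase 'F_2 w - 1) \in augIX 'F_2 gT 3.
Proof.
move=> v1 a2 ab3.
have b1 : b \in augI 'F_2 gT.
  rewrite memv_augI; have [->//|b1] := F2_cases (gaug b); case/negP: v1.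
  apply/eqP; apply: (gbaseB1_augIX2 F2_pchar gT2).
  have b0 : b - 1 \in augI 'F_2 gT by rewrite memv_augI raddfB /= b1 gaug1 subrr.
  have -> : gbase 'F_2 v - 1 = (gbase 'F_2 v - 1) * b - (gbase 'F_2 v - 1) * (b - 1).
    by rewrite mulrBr mulr1 opprB addrCA subrr addr0.
  rewrite memvB //; last by rewrite gbaseB1_augIX // augIX1.
  rewrite -[X in X \in _](subKr a) memvB //.
  exact: (subvP (augIXS _ _ 2)).
have [w bw] := augI_gbaseB1 b1; exists w.
have -> : a - (gbase 'F_2 v - 1) * (gbase 'F_2 w - 1) = a - (gbase 'F_2 v - 1) * b +
   (gbase 'F_2 v - 1) * (b - (gbase 'F_2 w - 1)).
  by rewrite [in RHS]mulrBr addrA subrK.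
by rewrite memvD // gbaseB1_augIX.
Qed.
(** The first hypothesis allows at most two terms. A single term in $I^2$ is zero; two terms add up
    to $[w_iw_j]-1$ modulo $I^2$, so $w_i=w_j$ and they cancel in characteristic 2. *)
Lemma gbaseB1_sum_augIX2 (I : finType) (P : pred I) (w : I -> gT) :
  (forall i j k, P i -> P j -> P k -> [\/ i = j, i = k | j = k]) ->
  \sum_(i | P i) (gbase 'F_2 (w i) - 1) \in augIX 'F_2 gT 2 ->
  \sum_(i | P i) (gbase 'F_2 (w i) - 1) = 0.
Proof.
move=> P2; have [i Pi|P0] := pickP P; last by rewrite big_pred0.
rewrite (bigD1 i) //=.
have [j /andP[Pj ji]|P0] := pickP (fun j => P j && (j != i)); last first.
  rewrite big_pred0 // addr0 => /(gbaseB1_augIX2 F2_pchar gT2)->.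
  by rewrite gbase1 subrr.
rewrite (bigD1 j) ?Pj //= big_pred0 => [|k]; last first.
  apply/negP => /andP[/andP[Pk ki] kj].
  by case: (P2 i j k Pi Pj Pk) => e; subst; rewrite eqxx in ji ki kj.
rewrite addr0 => ij2.
have wij : w i = w j.
  rewrite -[w i]mulg1 -(gT2 (w j)) mulgA (_ : (w i * w j)%g = 1%g) ?mul1g //.
  apply: (gbaseB1_augIX2 F2_pchar gT2).
  have -> : gbase 'F_2 (w i * w j)%g - 1 =
      (gbase 'F_2 (w i) - 1) * (gbase 'F_2 (w j) - 1) +
      (gbase 'F_2 (w i) - 1 + (gbase 'F_2 (w j) - 1)).
    rewrite gbaseB1M; move: (gbase _ (w i * w j)%g).
    move: (gbase _ (w i)) (gbase _ (w j)) (1 : A).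
    by move=> p q r t; apply/ffunP => x; rewrite !ffunE; ring.
  by rewrite memvD // gbaseB1_augIX // augIX1; apply: gbaseB1_augI.
by rewrite wij (addrr2 F2_pchar).
Qed.

End OverF2.

(** * Maps of group algebras induced by group homomorphisms *)

Section Push.
Variables (K : fieldType) (gT hT : finGroupType) (phi : gT -> hT).
Hypothesis phiM : {morph phi : x y / (x * y)%g}.
Implicit Types a b : galg K gT.

(** The map [pi_fun] is the case where [phi] is [Vproj sigma]. *)
Definition gpush a : galg K hT := \sum_c (a c : K) *: gbase K (phi c).

Fact gpush_is_linear : linear gpush.
Proof.
move=> k a b; rewrite /gpush scaler_sumr -big_split /=.
by apply: eq_bigr => c _; rewrite !ffunE scalerDl scalerA.
Qed.

HB.instance Definition _ :=
  GRing.isLinear.Build K (galg K gT) (galg K hT) _ gpush gpush_is_linear.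

Lemma gpushE a h : gpush a h = \sum_(c | phi c == h) (a c : K).
Proof.
rewrite /gpush sum_ffunE [RHS]big_mkcond; apply: eq_bigr => c _.
rewrite !ffunE eq_sym /GRing.scale /=.
by case: eqP; rewrite (mulr1, mulr0).
Qed.

Lemma gpush_gbase g : gpush (gbase K g) = gbase K (phi g).
Proof.
rewrite /gpush (bigD1 g) //= big1 ?addr0 => [|c /negbTE cg].
  by rewrite ffunE eqxx scale1r.
by rewrite ffunE cg scale0r.
Qed.

Lemma gpush1 : gpush 1 = 1.
Proof.
rewrite -gbase1 gpush_gbase -gbase1; congr gbase.
by apply: (mulgI (phi 1%g)); rewrite -phiM !mulg1.
Qed.

Lemma gpush_gbaseM g a : gpush (gbase K g * a) = gbase K (phi g) * gpush a.
Proof.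
rewrite /gpush mulr_sumr (reindex_inj (mulgI g)); apply: eq_bigr => c _ /=.
by rewrite gbase_mulE mulKg phiM -gbaseM scalerAr.
Qed.

Lemma gpush_gbaseB1M g a :
  gpush ((gbase K g - 1) * a) = (gbase K (phi g) - 1) * gpush a.
Proof. by rewrite mulrBl raddfB /= gpush_gbaseM !mul1r mulrBl mul1r. Qed.

Lemma gpush_gbaseB1 g : gpush (gbase K g - 1) = gbase K (phi g) - 1.
Proof. by rewrite raddfB /= gpush_gbase gpush1. Qed.

Lemma gaug_gpush a : gaug (gpush a) = gaug a.
Proof.
rewrite {2}[a]galg_sum /gpush !raddf_sum /=; apply: eq_bigr => c _.
by rewrite !linearZ /= !gaug_gbase.
Qed.

Lemma gpush_augIX q a : a \in augIX K gT q -> gpush a \in augIX K hT q.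
Proof.
elim: q a => [|q IHq] a aq; first exact: memvf.
have /subvP/(_ a aq) : (augIX K gT q.+1 <= linfun gpush @^-1: augIX K hT q.+1)%VS.
  apply: augIX_ind => g y yq; rewrite -memv_preim lfunE /= gpush_gbaseB1M.
  by rewrite gbaseB1_augIX ?IHq.
by rewrite -memv_preim lfunE.
Qed.

Lemma gpush_augIX_congr q a b : a - b \in augIX K gT q ->
  gpush a \in augIX K hT q -> gpush b \in augIX K hT q.
Proof.
move=> /gpush_augIX; rewrite raddfB /= => abq aq.
by have := memvB aq abq; rewrite opprB addrCA subrr addr0.
Qed.

(** Each factor $[h]-1$ lifts to $[g]-1$ for any preimage [g] of [h]. *)
Lemma gpush_augIX_surj q (b : galg K hT) : (forall h, exists g, phi g = h) ->
  b \in augIX K hT q -> exists2 a, a \in augIX K gT q & gpush a = b.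
Proof.
move=> phi_surj bq; suff /subvP/(_ b bq)/memv_imgP[a aq ->] :
    (augIX K hT q <= linfun gpush @: augIX K gT q)%VS.
  by exists a; rewrite ?lfunE.
elim: q {bq} => [|q IHq].
  apply/subvP => b' _; rewrite [b']galg_sum memv_suml // => h _.
  have [g <-] := phi_surj h; rewrite memvZ // -gpush_gbase.
  have -> : gpush (gbase K g) = linfun gpush (gbase K g) by rewrite lfunE.
  by rewrite memv_img ?memvf.
apply: augIX_ind => h y yq; have /memv_imgP[z zq ->] := subvP IHq y yq.
rewrite lfunE /=; have [g <-] := phi_surj h; rewrite -gpush_gbaseB1M.
have -> u : gpush u = linfun gpush u by rewrite lfunE.
by rewrite memv_img // gbaseB1_augIX.
Qed.

End Push.

(** The fibres of [phi] are the pairs $\{c,vc\}$, so over $\mathbb{F}_2$ the vanishing of the image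
    means that [a] is invariant under [v]; then [gbaseB1_divide] applies. *)
Lemma gpush_ker2 (gT hT : finGroupType) (phi : gT -> hT) (v : gT)
    (a : galg 'F_2 gT) :
  (forall x : gT, (x * x = 1)%g) -> {morph phi : x y / (x * y)%g} ->
  v != 1%g -> phi v = 1%g ->
  (forall g, phi g = 1%g -> g = 1%g \/ g = v) ->
  gpush phi a = 0 -> exists b, a = (gbase 'F_2 v - 1) * b.
Proof.
move=> gT2 phiM v1 phiv phi1 /ffunP a0; apply: gbaseB1_divide => // c.
have := a0 (phi c); rewrite gpushE ffunE (bigD1 c) //= (bigD1 (v * c)%g) /=; last first.
  rewrite phiM phiv mul1g eqxx /=; apply: contra v1 => /eqP vc.
  by apply/eqP; apply: (mulIg c); rewrite vc mul1g.
rewrite big1 => [|g /andP[/andP[/eqP gc g1] g2]]; last first.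
  have gcE : g = (g * c * c)%g by rewrite -mulgA gT2 mulg1.
  have [|gc1|gcv] := phi1 (g * c)%g.
  - by rewrite phiM gc -phiM gT2; apply: (mulgI (phi 1%g)); rewrite -phiM !mulg1.
  - by rewrite gcE gc1 mul1g eqxx in g1.
  - by rewrite gcE gcv eqxx in g2.
rewrite addr0 addrC => /eqP; rewrite addr_eq0 => /eqP e.
by rewrite e oppr_pchar2 ?F2_pchar.
Qed.

(** * Lattices and cones *)

Section Lattice.

(** In the Smith form $M=SDR$ the rows of $R$ at nonzero diagonal entries span the row space of $M$
    over $\mathbb{Q}$. As $R$ is unimodular, they form a basis of a saturated sublattice, and the
    matching columns of $R^{-1}$ give [P']. *)
Lemma saturated_basis k n (M : 'M[int]_(k, n)) :
  exists r (P : 'M[int]_(r, n)) (P' : 'M[int]_(n, r)),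
    P *m P' = 1%:M /\
    (map_mx (intr : int -> rat) M :=: map_mx (intr : int -> rat) P)%MS.
Proof.
have [S Sunit [R Runit [d _ ->]]] := int_Smith_normal_form M.
pose J := [set j : 'I_n | (j < k)%N && (d`_j != 0)]%SET.
exists #|J|, (rowsub enum_val R), (colsub enum_val (invmx R)); split.
  rewrite -mxsub_mul mulmxV //; apply/matrixP => i j.
  by rewrite !mxE (inj_eq enum_val_inj).
set D := \matrix_(i, j) _; pose q := @map_mx int rat intr.
rewrite -/(q _ _ (S *m D *m R)) -/(q _ _ (rowsub enum_val R)).
have rowDR i : row i (q _ _ D *m q _ _ R) =
    \sum_(j < n) (d`_i *+ (i == j :> nat))%:~R *: row j (q _ _ R).
  rewrite row_mul mulmx_sum_row; apply: eq_bigr => j _.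
  by rewrite !mxE.
have eqDR : (q _ _ (S *m D *m R) :=: q _ _ D *m q _ _ R)%MS.
  rewrite /q !map_mxM -mulmxA; apply: eqmxMfull; rewrite row_full_unit.
  by rewrite unitmxE det_map_mx rmorph_unit -?unitmxE.
apply: eqmx_trans eqDR _; apply/eqmxP/andP; split; apply/row_subP => i.
  rewrite rowDR summx_sub // => j _.
  case: eqP => [ij|_]; last by rewrite mulr0n scale0r sub0mx.
  have [->|di] := eqVneq d`_i 0; first by rewrite mul0rn scale0r sub0mx.
  have Jj : j \in J by rewrite inE -ij ltn_ord.
  rewrite scalemx_sub //
    (_ : row j _ = row (enum_rank_in Jj j) (q _ _ (rowsub enum_val R))).
    exact: row_sub.
  by apply/rowP => l; rewrite !mxE enum_rankK_in.
have := enum_valP i; set j := enum_val i; rewrite inE => /andP[jk dj].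
have -> : row i (q _ _ (rowsub enum_val R)) =
    ((d`_j)%:~R)^-1 *: row (Ordinal jk) (q _ _ D *m q _ _ R).
  rewrite rowDR (bigD1 j) //= eqxx mulr1n big1 ?addr0 => [|l]; last first.
    by rewrite eq_sym -val_eqE => /negbTE->; rewrite mulr0n scale0r.
  rewrite scalerA mulVf ?intr_eq0 // scale1r.
  by apply/rowP => l; rewrite !mxE.
by rewrite scalemx_sub // row_sub.
Qed.

Variable n : nat.
Implicit Types sigma tau : set 'rV[rat]_n.

Lemma is_span_Vect sigma (U : {vspace 'rV[rat]_n}) : is_span sigma U -> Vect sigma = U.
Proof.
move=> [sU minU]; have [sV minV] := VectP sigma.
by apply/eqP; rewrite eqEsubv minU // minV.
Qed.

Lemma mem_Vect_cone sigma : rational_polyhedral sigma ->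
  exists k (M : 'M[int]_(k, n)),
    forall x, (x \in Vect sigma) = (x <= map_mx (intr : int -> rat) M)%MS.
Proof.
move=> [k [v ->]]; exists k, (\matrix_i v i) => x.
set M := map_mx _ _; set sigma0 := (X in Vect X).
have rowM i : row i M = NtoQ (v i) by apply/rowP => j; rewrite !mxE.
pose U : {vspace 'rV[rat]_n} := limg (linfun (mulmxr M : 'rV[rat]_k -> _)).
have memU y : (y \in U) = (y <= M)%MS.
  apply/memv_imgP/submxP => [[c _ ->]|[c ->]]; first by exists c; rewrite lfunE.
  by exists c; rewrite ?memvf ?lfunE.
rewrite -memU; suff -> : Vect sigma0 = U by [].
apply: is_span_Vect; split=> [y [c c0 ->]|W sW].
  rewrite memv_suml // => i _; rewrite memvZ // memU -rowM; exact: row_sub.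
apply/subvP => y; rewrite memU => /submxP[c ->].
rewrite mulmx_sum_row memv_suml // => i _; rewrite memvZ // sW //.
exists (fun j => (i == j)%:R) => [j|]; first by rewrite ler0n.
rewrite (bigD1 i) //= eqxx scale1r big1 ?addr0 ?rowM // => j.
by rewrite eq_sym => /negbTE->; rewrite scale0r.
Qed.

(** The relation $PP'=1$ survives every change of ring: over $\mathbb{Q}$ it shows that the span has
    dimension [r], over $\mathbb{F}_2$ that the [r] rows of [P] stay independent in $N/2N$. *)
Lemma card_mod2_set sigma : rational_polyhedral sigma ->
  #|mod2_set sigma| = (2 ^ cdim sigma)%N.
Proof.
move=> /mem_Vect_cone[k [M memM]].
have [r [P [P' [PP' eqMP]]]] := saturated_basis M.
have {memM eqMP M k}memP x : (x \in Vect sigma) = (x <= map_mx (intr : int -> rat) P)%MS.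
  by rewrite memM eqMP.
have mapPP' (K : pzRingType) : map_mx (intr : int -> K) P *m map_mx intr P' = 1%:M.
  by rewrite -map_mxM PP' map_mx1.
have -> : cdim sigma = r.
  pose f := linfun (mulmxr (map_mx (intr : int -> rat) P) : 'rV[rat]_r -> 'rV[rat]_n).
  rewrite /cdim; have <- : limg f = Vect sigma.
    apply/vspaceP => x; rewrite memP.
    apply/memv_imgP/submxP => [[c _ ->]|[c ->]]; first by exists c; rewrite lfunE.
    by exists c; rewrite ?memvf ?lfunE.
  rewrite limg_dim_eq ?dimvf /dim /= ?mul1n //.
  apply/eqP; rewrite -subv0; apply/subvP => x.
  rewrite memv_cap memvf memv_ker lfunE /= => /eqP x0.
  by rewrite -[x]mulmx1 -(mapPP' rat) mulmxA x0 mul0mx mem0v.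
pose F (y : 'rV['F_2]_r) := y *m map_mx (intr : int -> 'F_2) P.
have -> : mod2_set sigma = [set F y | y in [set: 'rV['F_2]_r]]%SET.
  apply/setP => v; rewrite inE; apply/asboolP/imsetP => [[w wV ->]|[y _ ->]].
    have {wV}/submxP[c wP] : (NtoQ w <= map_mx (intr : int -> rat) P)%MS by rewrite -memP.
    (* Over $\mathbb{Q}$ the vector is a combination of the rows of [P], and [P'] extracts its
       coefficients, which are therefore integers. *)
    have -> : w = (w *m P') *m P.
      have /matrixP e : NtoQ w = NtoQ (w *m P' *m P).
        by rewrite [RHS]map_mxM map_mxM -/(NtoQ w) wP -(mulmxA c) mapPP' mulmx1.
      apply/matrixP => i j; have := e i j.
      by rewrite [LHS]mxE [RHS]mxE => /intr_inj.
    by exists (Nmod2 (w *m P')); rewrite ?inE // /Nmod2 map_mxM.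
  pose y' : 'rV[int]_r := \row_j (y 0 j : nat)%:Z.
  exists (y' *m P); first by rewrite memP /NtoQ map_mxM submxMl.
  rewrite /Nmod2 map_mxM; congr mulmx; apply/rowP => j; rewrite !mxE.
  by have [->|->] := F2_cases (y 0 j).
rewrite card_imset => [|y1 y2 eqF].
  by rewrite cardsT card_mx card_Fp ?mul1n.
by rewrite -[y1]mulmx1 -[y2]mulmx1 -(mapPP' 'F_2) !mulmxA; congr (_ *m _).
Qed.

Lemma face_subset tau sigma x : face tau sigma -> tau x -> sigma x.
Proof. by move=> [u _ ->] []. Qed.

Lemma Vect_face tau sigma : face tau sigma -> (Vect tau <= Vect sigma)%VS.
Proof.
move=> tf; have [_] := VectP tau; apply => x /(face_subset tf).
by have [sV _] := VectP sigma; apply: sV.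
Qed.

(** The supporting functional of the face vanishes at [t], hence on its whole line. *)
Lemma face_ray tau sigma : face tau sigma -> cdim tau = 1%N ->
  exists2 t, [/\ t != 0, tau t & sigma t] & forall x, tau x <-> sigma x /\ x \in <[t]>%VS.
Proof.
move=> tf dim1; have [sV minV] := VectP tau.
have [[t taut t0]|no_t] := pselect (exists2 t, tau t & t != 0); last first.
  have /minV : forall x, tau x -> x \in 0%VS.
    by move=> x taux; rewrite memv0; apply: contrapT => /negP x0; apply: no_t; exists x.
  by move/dimvS; rewrite -/(cdim tau) dim1 dimv0.
exists t; first by split=> //; apply: face_subset tf taut.
have Vt : <[t]>%VS = Vect tau.
  apply/eqP; rewrite eqEdim -memvE (sV _ taut) /= -/(cdim tau) dim1.
  by rewrite dim_vline t0.
move=> x; split=> [taux|[sx /vlineP[c xct]]].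
  by split; [apply: face_subset tf taux | rewrite Vt sV].
case: tf taut => u _ -> [_ /= ut]; split=> //=.
by rewrite xct -scalemxAl mxE ut mulr0.
Qed.

(* Two of the rays span the plane of [sigma]; supporting functionals show that
   the third one is a positive combination of them, hence lies in the interior. *)
Lemma plane_cone_rays tau1 tau2 tau3 sigma :
  face tau1 sigma -> face tau2 sigma -> face tau3 sigma ->
  cdim tau1 = 1%N -> cdim tau2 = 1%N -> cdim tau3 = 1%N -> cdim sigma = 2 ->
  [\/ tau1 = tau2, tau1 = tau3 | tau2 = tau3].
Proof.
move=> f1 f2 f3 d1 d2 d3 ds; have [sV _] := VectP sigma.
have ray_eq t1 t2 ta tb : t2 != 0 ->
    (forall x, ta x <-> sigma x /\ x \in <[t1]>%VS) ->
    (forall x, tb x <-> sigma x /\ x \in <[t2]>%VS) -> t2 \in <[t1]>%VS -> ta = tb.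
  move=> t20 tae tbe t21; have e12 : <[t2]>%VS = <[t1]>%VS.
    apply/eqP; rewrite eqEdim -memvE t21 !dim_vline t20.
    by case: (t1 != 0).
  by apply/seteqP; split=> x; rewrite tae tbe e12.
have [t1 [t10 tau1t s1] e1] := face_ray f1 d1.
have [t2 [t20 tau2t s2] e2] := face_ray f2 d2.
have [t3 [t30 tau3t s3] e3] := face_ray f3 d3.
have [t21|t21] := boolP (t2 \in <[t1]>%VS).
  by constructor 1; apply: ray_eq e1 e2 t21.
have [t12|t12] := boolP (t1 \in <[t2]>%VS).
  by constructor 1; apply/esym; apply: ray_eq e2 e1 t12.
have [t31|t31] := boolP (t3 \in <[t1]>%VS).
  by constructor 2; apply: ray_eq e1 e3 t31.
have [t32|t32] := boolP (t3 \in <[t2]>%VS).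
  by constructor 3; apply: ray_eq e2 e3 t32.
have span12 : (<[t1]> + <[t2]>)%VS = Vect sigma.
  apply/eqP; rewrite eqEdim -/(cdim sigma) ds subv_add -!memvE !sV //=.
  have : free [:: t1; t2] by rewrite free_cons span_seq1 t12 seq1_free.
  by rewrite /free span_cons span_seq1 => /eqP->.
have : t3 \in (<[t1]> + <[t2]>)%VS by rewrite span12 sV.
case/memv_addP=> _ /vlineP[a ->] [_ /vlineP[b ->] t3e].
(* The supporting functional of [ta] kills [x], is positive at [y] and nonnegative at [z]. *)
have coef_pos ta (x y z : 'rV[rat]_n) c d : face ta sigma -> ta x -> sigma y -> sigma z ->
    ~ ta y -> z = c *: x + d *: y -> 0 <= d.
  move=> [u u0 ->] [sx /= ux] sy sz tay ze.
  have uy : 0 < (y *m u) 0 0.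
    by rewrite lt_def u0 // andbT; apply/eqP => uy; apply: tay.
  have := u0 z sz; rewrite ze mulmxDl -!scalemxAl mxE.
  rewrite [X in _ <= X + _]mxE [X in _ <= _ + X]mxE.
  by rewrite ux mulr0 add0r pmulr_lge0.
have b0 : 0 <= b.
  by apply: coef_pos f1 tau1t s2 s3 _ t3e; rewrite e1 => -[_]; apply/negP.
have a0 : 0 <= a.
  rewrite addrC in t3e.
  by apply: coef_pos f2 tau2t s1 s3 _ t3e; rewrite e2 => -[_]; apply/negP.
have a_gt0 : 0 < a.
  rewrite lt_def a0 andbT; apply: contra t32 => /eqP a00.
  by rewrite t3e a00 scale0r add0r memvZ ?memv_line.
(* The functional of [tau3] is zero at [t3] and nonnegative at [t1] and [t2]; as $a>0$ and $b\ge0$,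
   it is zero at [t1], so [tau3] contains [t1]. *)
constructor 2; apply/esym; apply: (ray_eq _ _ _ _ _ e3 e1) => //.
suff: tau3 t1 by rewrite e3 => -[].
case: f3 tau3t => u u0 -> [_ /= /eqP u3]; split=> //=; apply/eqP; move: u3.
rewrite t3e mulmxDl -!scalemxAl mxE [X in X + _]mxE [X in _ + X]mxE.
by rewrite paddr_eq0 ?mulr_ge0 ?u0 // mulf_eq0 gt_eqF //= => /andP[].
Qed.

Lemma cdim0_cone sigma : rational_polyhedral sigma -> cdim sigma = 0%N ->
  sigma = [set 0]%classic.
Proof.
move=> [k [v sE]] /eqP; rewrite /cdim dimv_eq0 => /eqP V0.
have [sV _] := VectP sigma; apply/seteqP; split=> [x /sV|x ->].
  by rewrite V0 memv0 => /eqP.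
rewrite sE; exists (fun=> 0) => //; rewrite big1 // => i _.
by rewrite scale0r.
Qed.

End Lattice.

(** * The groups $V/[\sigma]_2$ and the projections between them *)

Section Quotients.
Variables (n : nat) (Delta : {fset set 'rV[rat]_n}).
Implicit Types sigma tau : Delta.

Lemma mod2_norm (s : set 'rV[rat]_n) (x : 'rV['F_2]_n) :
  x \in ('N(mod2_set s))%g.
Proof.
have abV := FinRing.Theory.zmod_abelian [set: 'rV['F_2]_n]%SET.
apply: (fintype.subsetP (sub_abelian_norm abV (finset.subsetT _))).
by rewrite inE.
Qed.

Lemma Vquo_coset sigma (c : Vquo sigma) :
  exists x, c = coset (mod2_set (fsval sigma)) x.
Proof. by have [x _ ->] := cosetP c; exists x. Qed.

Lemma Vquo_sq sigma (c : Vquo sigma) : (c * c = 1)%g.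
Proof.
have [x ->] := Vquo_coset c.
rewrite -morphM ?mod2_norm // (_ : (x * x)%g = 1%g) ?morph1 //.
exact: (addrr2 F2_pchar (x : 'rV['F_2]_n)).
Qed.

Lemma card_Vquo sigma : rational_polyhedral (fsval sigma) ->
  (#|Vquo sigma| * 2 ^ cdim (fsval sigma))%N = (2 ^ n)%N.
Proof.
move=> /card_mod2_set <-; rewrite -cardsT -quotientT.
rewrite card_quotient; last by apply/fintype.subsetP => x _; apply: mod2_norm.
by rewrite mulnC Lagrange ?finset.subsetT // cardsT card_mx card_Fp // mul1n.
Qed.

Lemma mod2_set_face (s t : set 'rV[rat]_n) : face t s ->
  mod2_set t \subset mod2_set s.
Proof.
move=> /Vect_face sV; apply/fintype.subsetP => v; rewrite !inE.
move=> /asboolP[w wV ->]; apply/asboolP; exists w => //.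
exact: (subvP sV).
Qed.

Section Face.
Variables tau sigma : Delta.
Hypothesis tau_sigma : mod2_set (fsval tau) \subset mod2_set (fsval sigma).

(** The representative chosen in [Vproj] is off by an element of $[\tau]_2$, which dies in
    $V/[\sigma]_2$. *)
Lemma VprojE x :
  Vproj sigma (coset (mod2_set (fsval tau)) x) = coset (mod2_set (fsval sigma)) x.
Proof.
rewrite /Vproj; have := mem_repr_coset (coset (mod2_set (fsval tau)) x).
rewrite val_coset ?mod2_norm // => /rcosetP[h th ->].
by rewrite coset_kerl // (fintype.subsetP tau_sigma).
Qed.

Lemma VprojM : {morph @Vproj n Delta tau sigma : c d / (c * d)%g}.
Proof.
move=> c d; have [x ->] := Vquo_coset c; have [y ->] := Vquo_coset d.
by rewrite -morphM ?mod2_norm // !VprojE morphM ?mod2_norm.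
Qed.

Lemma Vproj_surj (d : Vquo sigma) : exists c : Vquo tau, Vproj sigma c = d.
Proof.
have [x ->] := Vquo_coset d; exists (coset (mod2_set (fsval tau)) x).
exact: VprojE.
Qed.

(** Here $[\tau]_2$ is zero and $[\sigma]_2$ has one nonzero element, whose class is [v]. *)
Lemma Vproj_ker_ray : #|mod2_set (fsval tau)| = 1%N ->
  #|mod2_set (fsval sigma)| = 2%N ->
  exists v : Vquo tau, [/\ v != 1%g, Vproj sigma v = 1%g &
    forall c : Vquo tau, Vproj sigma c = 1%g -> c = 1%g \/ c = v].
Proof.
move=> t1 s2; have tau1 : mod2_set (fsval tau) = [1]%g.
  by apply: (@card1_trivg _ (mod2_group (fsval tau))).
have s1 : (1%g : 'rV['F_2]_n) \in mod2_set (fsval sigma).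
  exact: (group1 (mod2_group _)).
have : #|mod2_set (fsval sigma) :\ 1%g| == 1%N.
  by have := cardsD1 1%g (mod2_set (fsval sigma)); rewrite s2 s1 add1n => -[<-].
case/cards1P => v0 v0E.
have mem_s x : x \in mod2_set (fsval sigma) -> x = 1%g \/ x = v0.
  have [->|x1] := eqVneq x 1%g; first by left.
  move=> xs; right; apply/eqP; have := in_setD1 x (mod2_set (fsval sigma)) 1%g.
  by rewrite v0E inE x1 xs => ->.
have := set11 v0; rewrite -v0E in_setD1 => /andP[v01 v0s].
exists (coset (mod2_set (fsval tau)) v0); split.
- apply: contra v01 => /eqP /coset_idr; rewrite mod2_norm => /(_ isT).
  by rewrite /= tau1 inE.
- by rewrite VprojE coset_id.
move=> c; have [x ->] := Vquo_coset c; rewrite VprojE.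
move=> /coset_idr; rewrite mod2_norm => /(_ isT)/mem_s[]->; last by right.
by left; rewrite morph1.
Qed.

Lemma pi_E a : pi_ tau sigma a = gpush (@Vproj n Delta tau sigma) a.
Proof. by rewrite lfunE. Qed.

End Face.
End Quotients.

(** * Strictness of the differential *)

Section Chains.
Variables (n : nat) (Delta : {fset set 'rV[rat]_n}).
Implicit Types (sigma tau : Delta) (x y : chains Delta).

Lemma proj_inj sigma (a : A_ sigma) : proj_ sigma (inj_ sigma a) = a.
Proof.
rewrite !lfunE /=; apply/ffunP=> c; rewrite !ffunE /=.
by case: eqP => // e; rewrite (eq_axiomK e).
Qed.

Lemma proj_inj_neq sigma tau (a : A_ tau) : tau != sigma ->
  proj_ sigma (inj_ tau a) = 0.
Proof.
move=> ts; rewrite !lfunE /=; apply/ffunP=> c; rewrite !ffunE /=.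
by case: eqP => // e; rewrite e eqxx in ts.
Qed.

Lemma chains_ext x y : (forall sigma, proj_ sigma x = proj_ sigma y) -> x = y.
Proof.
move=> xy; apply/ffunP=> -[sigma c]; have := xy sigma.
by rewrite !lfunE /= => /ffunP/(_ c); rewrite !ffunE.
Qed.

Definition mkchain (f : forall sigma, A_ sigma) : chains Delta :=
  \sum_(sigma : Delta) inj_ sigma (f sigma).

Lemma proj_mkchain f sigma : proj_ sigma (mkchain f) = f sigma.
Proof.
rewrite linear_sum /= (bigD1 sigma) //= proj_inj big1 ?addr0 // => tau ts.
exact: proj_inj_neq.
Qed.

Lemma mem_IA q p x :
  (forall sigma, (cdim (fsval sigma))%:Z = n%:Z - p ->
     proj_ sigma x \in augIX 'F_2 (Vquo sigma) q) ->
  (forall sigma, (cdim (fsval sigma))%:Z <> n%:Z - p -> proj_ sigma x = 0) ->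
  x \in IA Delta q p.
Proof.
move=> xq x0; have -> : x = \sum_sigma inj_ sigma (proj_ sigma x).
  by apply: chains_ext => sigma; rewrite (proj_mkchain (fun s => proj_ s x)).
rewrite (bigID (fun sigma => (cdim (fsval sigma))%:Z == n%:Z - p)) /=.
rewrite [X in _ + X]big1 ?addr0 => [|sigma /eqP/x0->]; last by rewrite linear0.
apply: memv_sumr => sigma /eqP/xq xs; exact: memv_img.
Qed.

Lemma IA_deg q p x sigma : x \in IA Delta q p ->
  (cdim (fsval sigma))%:Z <> n%:Z - p -> proj_ sigma x = 0.
Proof.
move=> /memv_sumP[f fq ->] ds; rewrite linear_sum big1 //= => tau dt.
have /memv_imgP[a _ ->] := fq tau dt; apply: proj_inj_neq.
by apply: contraPneq ds => <- /(_ (eqP dt)).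
Qed.

Lemma IA_proj q p x sigma : x \in IA Delta q p ->
  proj_ sigma x \in augIX 'F_2 (Vquo sigma) q.
Proof.
move=> /memv_sumP[f fq ->]; rewrite linear_sum memv_suml //= => tau dt.
have /memv_imgP[a aq ->] := fq tau dt.
have [ts|ts] := eqVneq tau sigma; last by rewrite proj_inj_neq // mem0v.
by subst tau; rewrite proj_inj.
Qed.

Lemma IAS q p : (IA Delta q.+1 p <= IA Delta q p)%VS.
Proof.
apply/subvP => x xq; apply: mem_IA => sigma ds; last exact: IA_deg xq ds.
by apply: (subvP (augIXS _ _ _)); apply: IA_proj xq.
Qed.

Lemma proj_bdry x sigma :
  proj_ sigma (bdry Delta x) = \sum_(tau | facet tau sigma) pi_ tau sigma (proj_ tau x).
Proof.
rewrite /bdry sum_lfunE linear_sum /= [RHS]big_mkcond; apply: eq_bigr => tau _.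
rewrite sum_lfunE linear_sum /=; case: ifPn => ts.
  rewrite (bigD1 sigma) //= !comp_lfunE proj_inj big1 ?addr0 // => s /andP[_ ss].
  by rewrite !comp_lfunE proj_inj_neq.
rewrite big1 // => s ss; rewrite !comp_lfunE proj_inj_neq //.
by apply: contraNneq ts => <-.
Qed.

Lemma facet_face tau sigma : facet tau sigma -> face (fsval tau) (fsval sigma).
Proof. by move=> /andP[/asboolP]. Qed.

Lemma facet_cdim tau sigma : facet tau sigma ->
  cdim (fsval sigma) = (cdim (fsval tau)).+1.
Proof. by move=> /andP[_ /eqP]. Qed.

Lemma facet_mod2 tau sigma : facet tau sigma ->
  mod2_set (fsval tau) \subset mod2_set (fsval sigma).
Proof. by move=> /facet_face/mod2_set_face. Qed.

Lemma proj_bdry_augIX q x sigma :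
  (forall tau, proj_ tau x \in augIX 'F_2 (Vquo tau) q) ->
  proj_ sigma (bdry Delta x) \in augIX 'F_2 (Vquo sigma) q.
Proof.
move=> xq; rewrite proj_bdry memv_suml // => tau ts; rewrite pi_E.
have piI := gpush_augIX (VprojM (facet_mod2 ts)) (xq tau); exact: piI.
Qed.

Lemma bdry_IA q p x : x \in IA Delta q p -> bdry Delta x \in IA Delta q (p - 1).
Proof.
move=> xq; apply: mem_IA => sigma ds.
  by apply: proj_bdry_augIX => tau; apply: IA_proj xq.
rewrite proj_bdry big1 // => tau ts; rewrite (IA_deg xq) ?linear0 //.
by have := facet_cdim ts; lia.
Qed.

Lemma bdry_inj_eq0 tau (a : A_ tau) :
  (forall sigma, facet tau sigma -> pi_ tau sigma a = 0) ->
  bdry Delta (inj_ tau a) = 0.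
Proof.
move=> a0; apply: chains_ext => sigma; rewrite proj_bdry linear0.
apply: big1 => t ts; have [tt|tt] := eqVneq tau t.
  by subst t; rewrite proj_inj a0.
rewrite (proj_inj_neq a tt); exact: linear0.
Qed.

Lemma gaug_proj_bdry x sigma :
  gaug (proj_ sigma (bdry Delta x)) = \sum_(tau | facet tau sigma) gaug (proj_ tau x).
Proof.
rewrite proj_bdry raddf_sum; apply: eq_bigr => tau ts /=.
by rewrite pi_E gaug_gpush.
Qed.

(** At [sigma], the subtracted multiples of 1 contribute the sum of the augmentations over the
    facets, which is the augmentation of the boundary of [x] there, hence zero. *)
Lemma bdry_strict1 m x : x \in IA Delta 0 m -> bdry Delta x \in IA Delta 1 (m - 1) ->
  exists2 y, y \in IA Delta 1 m & bdry Delta y = bdry Delta x.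
Proof.
move=> xm dx.
exists (mkchain (fun tau => proj_ tau x - (gaug (proj_ tau x) : 'F_2) *: 1)).
  apply: mem_IA => sigma ds; rewrite proj_mkchain; last first.
    by rewrite (IA_deg xm ds) linear0 scale0r subr0.
  by rewrite augIX1 memv_augI linearB linearZ /= gaug1 /GRing.scale /= mulr1 subrr.
apply: chains_ext => sigma; rewrite proj_bdry.
have : gaug (proj_ sigma (bdry Delta x)) = 0.
  by have := IA_proj sigma dx; rewrite augIX1 memv_augI => /eqP.
rewrite gaug_proj_bdry proj_bdry => aug0.
under eq_bigr => tau ts.
  rewrite proj_mkchain linearB linearZ /= (pi_E sigma (1 : A_ tau)).
  rewrite (gpush1 _ (VprojM (facet_mod2 ts))); over.
by rewrite sumrB -scaler_suml aug0 scale0r subr0.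
Qed.

Lemma pi_gbaseB1 tau sigma (c : Vquo tau) : facet tau sigma ->
  pi_ tau sigma (gbase 'F_2 c - 1) = gbase 'F_2 (Vproj sigma c) - 1.
Proof.
move=> ts.
by rewrite pi_E (gpush_gbaseB1 _ (VprojM (facet_mod2 ts))).
Qed.

Lemma bdry_strict2 m x :
  (forall sigma tau1 tau2 tau3, (cdim (fsval sigma))%:Z = n%:Z - (m - 1) ->
     facet tau1 sigma -> facet tau2 sigma -> facet tau3 sigma ->
     [\/ tau1 = tau2, tau1 = tau3 | tau2 = tau3]) ->
  x \in IA Delta 1 m -> bdry Delta x \in IA Delta 2 (m - 1) ->
  exists2 y, y \in IA Delta 2 m & bdry Delta y = bdry Delta x.
Proof.
move=> le2 xm dx.
have ex_w tau : exists c : Vquo tau,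
    proj_ tau x - (gbase 'F_2 c - 1) \in augIX 'F_2 (Vquo tau) 2.
  by apply: augI_gbaseB1; rewrite -augIX1; apply: IA_proj xm.
pose w tau := xchoose (ex_w tau).
have wP tau : proj_ tau x - (gbase 'F_2 (w tau) - 1) \in augIX 'F_2 (Vquo tau) 2.
  exact: xchooseP (ex_w tau).
(* This keeps [y] homogeneous of degree [m]. *)
have w1 tau : (cdim (fsval tau))%:Z <> n%:Z - m -> w tau = 1%g.
  move=> dt; apply: (gbaseB1_augIX2 F2_pchar (@Vquo_sq _ _ _)).
  by have := wP tau; rewrite (IA_deg xm dt) sub0r memvN.
set y := mkchain (fun tau => proj_ tau x - (gbase 'F_2 (w tau) - 1)).
have yP tau : proj_ tau y = proj_ tau x - (gbase 'F_2 (w tau) - 1).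
  by rewrite proj_mkchain.
have ym : y \in IA Delta 2 m.
  apply: mem_IA => tau dt; rewrite yP; first exact: wP.
  by rewrite (IA_deg xm dt) w1 // gbase1 subrr subr0.
exists y => //; apply: chains_ext => sigma.
have dE : proj_ sigma (bdry Delta y) = proj_ sigma (bdry Delta x) -
    \sum_(tau | facet tau sigma) (gbase 'F_2 (Vproj sigma (w tau)) - 1).
  rewrite !proj_bdry -sumrB; apply: eq_bigr => tau ts.
  by rewrite yP linearB /= pi_gbaseB1.
rewrite dE.
have [ds|/eqP ds] := eqVneq (cdim (fsval sigma))%:Z (n%:Z - (m - 1)); last first.
  rewrite big1 ?subr0 // => tau ts; rewrite w1; last by have := facet_cdim ts; lia.
  by rewrite -pi_gbaseB1 // gbase1 subrr linear0.
rewrite gbaseB1_sum_augIX2 ?subr0 //; first exact: Vquo_sq.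
  by move=> t1 t2 t3; apply: le2.
(* The boundaries of [x] and [y] both lie in $I^2$, hence so does the sum by which they differ. *)
have := IA_proj sigma (bdry_IA ym); rewrite dE => dy.
have := memvB (IA_proj sigma dx) dy.
by rewrite opprB addrC subrK.
Qed.

Lemma bdry_strict3 m x : (forall sigma, rational_polyhedral (fsval sigma)) ->
  m = n%:Z ->
  x \in IA Delta 2 m -> bdry Delta x \in IA Delta 3 (m - 1) ->
  exists2 y, y \in IA Delta 3 m & bdry Delta y = bdry Delta x.
Proof.
move=> poly -> xm dx.
have [d0|] := eqVneq (bdry Delta x) 0.
  by exists 0; rewrite ?mem0v // d0 linear0.
(* A nonzero boundary has a nonzero component at some ray [sigma], which will supply [v]. *)
move=> d_neq0; have [sigma ds0] : exists sigma, proj_ sigma (bdry Delta x) != 0.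
  apply: contrapT => none; case/eqP: d_neq0; apply: chains_ext => sigma.
  by rewrite linear0; apply: contrapT => /eqP ds; apply: none; exists sigma.
have deg0 tau : proj_ tau x != 0 -> cdim (fsval tau) = 0%N.
  by move=> xt; apply: contra_neq_eq xt => dt; apply: (IA_deg xm); lia.
have [tau ts xt] : exists2 tau, facet tau sigma & proj_ tau x != 0.
  apply: contrapT => none; case/eqP: ds0; rewrite proj_bdry big1 // => tau ts.
  have [->|xt] := eqVneq (proj_ tau x) 0; first by rewrite linear0.
  by case: none; exists tau.
have dt := deg0 _ xt.
have uniq0 s : cdim (fsval s) = 0%N -> s = tau.
  move=> s0; apply: val_inj => /=.
  by rewrite (cdim0_cone (poly s)) // (cdim0_cone (poly tau)).
have x_neq s : s != tau -> proj_ s x = 0.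
  by move=> st; apply: contraNeq st => /deg0/uniq0->.
have [v [v1 phiv ker_phi]] : exists v : Vquo tau,
  [/\ v != 1%g, Vproj sigma v = 1%g &
    forall c : Vquo tau, Vproj sigma c = 1%g -> c = 1%g \/ c = v].
  apply: Vproj_ker_ray (facet_mod2 ts) _ _; rewrite card_mod2_set //.
    by rewrite dt.
  by rewrite (facet_cdim ts) dt.
set X := proj_ tau x.
have dxE s : facet tau s -> proj_ s (bdry Delta x) = gpush (@Vproj n Delta tau s) X.
  move=> ts'; rewrite proj_bdry (bigD1 tau) //= big1 ?addr0 ?pi_E // => t /andP[_ tt].
  by rewrite x_neq // linear0.
have phi3 s : facet tau s -> gpush (@Vproj n Delta tau s) X \in augIX 'F_2 (Vquo s) 3.
  by move=> ts'; rewrite -dxE //; apply: (IA_proj s dx).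
have phiM := VprojM (facet_mod2 ts).
(* Correcting [X] by [z] in $I^3$ puts it in the kernel of the projection to $V/[\sigma]_2$, hence
   makes it divisible by $[v]-1$. *)
have [z z3 zX] := gpush_augIX_surj phiM (Vproj_surj (facet_mod2 ts)) (phi3 _ ts).
have [b Xb] : exists b, X - z = (gbase 'F_2 v - 1) * b.
  apply: (gpush_ker2 (@Vquo_sq _ _ _) phiM v1 phiv ker_phi).
  by rewrite linearB /= zX subrr.
have [w Xw] : exists w,
    X - (gbase 'F_2 v - 1) * (gbase 'F_2 w - 1) \in augIX 'F_2 (Vquo tau) 3.
  apply: (augIX2_mod_augIX3 (b := b) (@Vquo_sq _ _ _) v1 (IA_proj tau xm)).
  by rewrite -/X -Xb opprB addrCA subrr addr0.
set Y := _ * _ in Xw.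
(* Since [X] and [Y] agree modulo $I^3$, the image of [Y] at every ray lies in $I^3$ like that of
   [X], so it is zero by [gbaseB1M_augIX3]. *)
exists (x - inj_ tau Y).
  apply: mem_IA => s s0; rewrite linearB /=.
    have -> : s = tau by apply: uniq0; move: s0; rewrite subrr => -[].
    by rewrite proj_inj.
  have st : s != tau by apply: contra_not_neq s0 => ->; rewrite dt subrr.
  rewrite (x_neq s st) proj_inj_neq; last by rewrite eq_sym.
  exact: subr0.
suff dY : bdry Delta (inj_ tau Y) = 0 by rewrite linearB /= dY subr0.
apply: bdry_inj_eq0 => s ts'; rewrite pi_E.
have phiM' := VprojM (facet_mod2 ts').
have YE : gpush (@Vproj n Delta tau s) Y =
    (gbase 'F_2 (Vproj s v) - 1) * (gbase 'F_2 (Vproj s w) - 1).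
  by rewrite (gpush_gbaseB1M phiM') (gpush_gbaseB1 _ phiM').
rewrite YE; apply: (gbaseB1M_augIX3 F2_pchar (@Vquo_sq _ _ _)); rewrite -YE.
exact: (gpush_augIX_congr phiM' Xw (phi3 _ ts')).
Qed.

End Chains.

(** * Vanishing ranges, and strictness in dimension 4 *)

Section Strictness.
Variables (n : nat) (Delta : {fset set 'rV[rat]_n}).
Implicit Types (sigma tau : Delta) (x : chains Delta).

Lemma IA_le i j p : (i <= j)%N -> (IA Delta j p <= IA Delta i p)%VS.
Proof.
move=> /subnK<-; elim: (j - i)%N => //= k; apply: subv_trans; exact: IAS.
Qed.

(** The summands of $A_p$ are algebras of groups of order $2^p<2^q$. *)
Lemma IA_eq0 q p x : (forall sigma, rational_polyhedral (fsval sigma)) ->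
  p < q%:Z -> x \in IA Delta q p -> x = 0.
Proof.
move=> poly pq xq; apply: chains_ext => sigma; rewrite linear0.
have [ds|/eqP ds] := eqVneq (cdim (fsval sigma))%:Z (n%:Z - p); last exact: IA_deg xq ds.
have := IA_proj sigma xq; apply: augIX_eq0 F2_pchar (@Vquo_sq _ _ _) _ _ _.
rewrite ltnNge; apply/negP => leV.
have : (2 ^ (q + cdim (fsval sigma)) <= 2 ^ n)%N.
  by rewrite -(card_Vquo (poly sigma)) expnD leq_mul2r leV orbT.
by rewrite leq_exp2l //; lia.
Qed.

Lemma facets_le2 sigma tau1 tau2 tau3 :
  (forall sigma, rational_polyhedral (fsval sigma)) ->
  (cdim (fsval sigma) <= 2)%N ->
  facet tau1 sigma -> facet tau2 sigma -> facet tau3 sigma ->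
  [\/ tau1 = tau2, tau1 = tau3 | tau2 = tau3].
Proof.
move=> poly s2 f1 f2 f3.
have d1 := facet_cdim f1; have d2 := facet_cdim f2; have d3 := facet_cdim f3.
have [s2e|s1] := eqVneq (cdim (fsval sigma)) 2.
  have := plane_cone_rays (facet_face f1) (facet_face f2) (facet_face f3).
  by case; [lia| lia | lia| | | |] => // /val_inj e;
    [constructor 1 | constructor 2 | constructor 3].
have z1 : cdim (fsval tau1) = 0%N by lia.
have z2 : cdim (fsval tau2) = 0%N by lia.
constructor 1; apply: val_inj.
exact: etrans (cdim0_cone (poly tau1) z1) (esym (cdim0_cone (poly tau2) z2)).
Qed.

End Strictness.

Lemma bdry_strict_dim4 (Delta : {fset set 'rV[rat]_4}) (q : nat) (m : int)
    (x : chains Delta) :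
  is_fan Delta -> x \in IA Delta 0 m -> bdry Delta x \in IA Delta q (m - 1) ->
  exists2 y, y \in IA Delta q m & bdry Delta y = bdry Delta x.
Proof.
move=> [_ fan _ _]; have poly (sigma : Delta) : rational_polyhedral (fsval sigma).
  by case: (fan _ (fsvalP sigma)).
case: q => [|q] xm dx; first by exists x.
have [y1 y1m dy1] := bdry_strict1 xm (subvP (IA_le _ _ (ltn0Sn q)) _ dx).
case: q dx => [|q] dx; first by exists y1.
rewrite -dy1 in dx *.
(* The exponent is now [q + 2]; if it is at least [m], the boundary lies in $I^{q+2}A_{m-1}=0$. *)
have [mq|qm] := leP m q.+2%:Z.
  exists 0; rewrite ?mem0v // linear0; apply/esym.
  by apply: (IA_eq0 poly _ dx); lia.
have [m4|m4] := ltP 4%:Z m.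
  exists 0; rewrite ?mem0v // linear0 (_ : y1 = 0) ?linear0 //.
  by apply: chains_ext => s; rewrite linear0; apply: IA_deg y1m _; lia.
(* Here $3\le m\le4$, so the cones of degree $m-1$ have dimension $5-m\le2$. *)
have [y2 y2m dy2] : exists2 y, y \in IA Delta 2 m & bdry Delta y = bdry Delta y1.
  apply: bdry_strict2 y1m _; last exact: (subvP (IA_le _ _ (leq_addr q 2)) _ dx).
  by move=> s t1 t2 t3 ds; apply: (facets_le2 poly); lia.
rewrite -dy2 in dx *; case: q qm dx => [|q] qm dx; first by exists y2.
have [q0 m44] : q = 0%N /\ m = 4 by lia.
by rewrite q0 in dx *; apply: bdry_strict3.
Qed.

(** * From strictness to degeneration *)

Section Pages.
Variables (n : nat) (Delta : {fset set 'rV[rat]_n}).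

Definition filt_index (P : int) : nat := if P is Negz m then m.+1 else 0.

Lemma filtE P p : filt Delta P p = IA Delta (filt_index P) p.
Proof. by case: P. Qed.

Lemma filt_index_pred P : (filt_index P <= filt_index (P - 1))%N.
Proof.
by case: P => [//|m]; rewrite (_ : Negz m - 1 = Negz m.+1) //=; lia.
Qed.

Lemma filt_pred P p : (filt Delta (P - 1) p <= filt Delta P p)%VS.
Proof. by rewrite !filtE IA_le ?filt_index_pred. Qed.

Lemma filt_sub0 P p : (filt Delta P p <= IA Delta 0 p)%VS.
Proof. by rewrite filtE IA_le. Qed.

Lemma bdry_filt P p x : x \in filt Delta P p -> bdry Delta x \in filt Delta P (p - 1).
Proof. by rewrite !filtE; apply: bdry_IA. Qed.

(** If the boundary of [x] lies in $F_{P-1}$, strictness gives [y] in $F_{P-1}$ with the same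
    boundary, so [x] is a cycle modulo $F_{P-1}$. Likewise a boundary lying in $F_P$ is the boundary
    of a chain in $F_P$. *)
Lemma degenerate_of_strict (P p : int) :
  (forall (q : nat) (m : int) (x : chains Delta),
    x \in IA Delta 0 m -> bdry Delta x \in IA Delta q (m - 1) ->
    exists2 y, y \in IA Delta q m & bdry Delta y = bdry Delta x) ->
  ss_page_oo (bdry Delta) (filt Delta) (IA Delta 0) P p =
  ss_page (bdry Delta) (filt Delta) 1 P p.
Proof.
move=> strict; rewrite /ss_page_oo /ss_page /ss_cycles; congr pair.
  apply/eqP; rewrite eqEsubv !subv_add !addvSr !andbT; apply/andP; split.
    apply: subv_trans (addvSl _ _); apply/subvP => x.
    rewrite !memv_cap memv_ker => /andP[-> /eqP dx].
    by rewrite -memv_preim dx mem0v.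
  apply/subvP => x; rewrite memv_cap -memv_preim => /andP[xP].
  rewrite filtE => dx; have [y yP dy] := strict _ _ _ (subvP (filt_sub0 _ _) _ xP) dx.
  rewrite -filtE in yP; rewrite -(subrK y x) memv_add // memv_cap.
  rewrite memvB ?(subvP (filt_pred _ _) _ yP) //=.
  by rewrite memv_ker linearB /= dy subrr.
(* For $r=1$ the shifts $r-1$ and $P+r-1$ are 0 and $P$, so the boundaries on page 1 come from $F_P$
   itself. *)
rewrite subrr subr0 !addrK.
apply/eqP; rewrite eqEsubv !subv_add !addvSr !andbT; apply/andP; split.
  apply: subv_trans (addvSl _ _); apply/subvP => z.
  rewrite memv_cap => /andP[zP /memv_imgP[x xm ze]]; move: zP.
  rewrite ze filtE -[p in IA _ _ p](addrK 1) => dx.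
  have [y yP <-] := strict _ _ _ xm dx; rewrite -filtE in yP.
  rewrite memv_img // memv_cap yP -memv_preim.
  by rewrite -filtE bdry_filt.
apply: subv_trans (addvSl _ _); apply/subvP => _ /memv_imgP[x + ->].
rewrite memv_cap => /andP[xP dx]; rewrite memv_cap memv_preim dx memv_img //.
exact: (subvP (filt_sub0 _ _) _ xP).
Qed.

End Pages.

Theorem mainTheorem2 (Delta : {fset set 'rV[rat]_4}) (hDelta : is_fan Delta)
  (p q : int) : G_oo Delta p q = G Delta 1 p q.
Proof. by apply: degenerate_of_strict => k m x; apply: bdry_strict_dim4. Qed.
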